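(* Let $r\ge 1$, let $\mathbf{a}=(a_1,\dots,a_r)$ be a vector of positive integers, let $D=\mathrm{lcm}(a_1,\dots,a_r)$, and let $$\mathbf{J}=\Big\{\mathbf{j}=(j_1,\dots,j_r)\in\mathbb{Z}^r:\ 0\le j_i\le \tfrac{D}{a_i}-1 \text{ for } i=1,\dots,r\Big\}.$$ Then the polynomial part $\mathrm{Poly}_{\mathbf{a}}(n)$ of the restricted partition function $p_{\mathbf{a}}(n)$ satisfies, as an identity of polynomials in $n$, $$\mathrm{Poly}_{\mathbf{a}}(n)=\frac{1}{D}\sum_{\mathbf{j}\in\mathbf{J}}\binom{\frac{n-a_1j_1-\cdots-a_rj_r}{D}+r-1}{r-1}.$$
   Context: For a vector $\mathbf{a}=(a_1,\dots,a_r)$ of positive integers and an integer $n\ge 0$, the restricted partition function is $$p_{\mathbf{a}}(n)=\#\Big\{(x_1,\dots,x_r)\in\mathbb{Z}_{\ge 0}^r:\ \sum_{i=1}^r a_ix_i=n\Big\}.$$ The binomial coefficient is the polynomial $\binom{x}{r-1}=\frac{x(x-1)\cdots(x-r+2)}{(r-1)!}$ in $x$ (equal to $1$ when $r=1$), so it makes sense for rational $x$. Polynomial part: with $D=\mathrm{lcm}(a_1,\dots,a_r)$, there are unique polynomials $P_\lambda\in\mathbb{C}[n]$, indexed by the complex numbers $\lambda$ with $\lambda^D=1$, such that $p_{\mathbf{a}}(n)=\sum_{\lambda^D=1}P_\lambda(n)\lambda^n$ for all integers $n\ge 0$. The polynomial part is $\mathrm{Poly}_{\mathbf{a}}(n):=P_1(n)$,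 i.e. the contribution of the pole at $z=1$ in the partial fraction expansion of $\sum_{n\ge 0}p_{\mathbf{a}}(n)z^n=\prod_{k=1}^r\frac{1}{1-z^{a_k}}$. When the $a_i$ are pairwise coprime, this is the polynomial determined by $$p_{\mathbf{a}}(n)=\mathrm{Poly}_{\mathbf{a}}(n)+\sum_{i=1}^r s_{-n}(a_1,\dots,\widehat{a_i},\dots,a_r;a_i),$$ where $\widehat{a_i}$ means that $a_i$ is omitted and the Fourier-Dedekind sums are $$s_n(c_1,\dots,c_m;b)=\frac1b\sum_{j=1}^{b-1}\frac{\xi_b^{jn}}{(1-\xi_b^{jc_1})\cdots(1-\xi_b^{jc_m})},\qquad \xi_b=e^{2\pi i/b}.$$ *)

(* Defs.v *)
(* Mathematical Components, with mathcomp-classical for finitely supported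
   sums over sets and for choice. *)
From mathcomp Require Import all_boot all_order all_algebra.
From mathcomp Require Import boolp classical_sets cardinality fsbigop.

Set Implicit Arguments.
Unset Strict Implicit.
Unset Printing Implicit Defensive.

Import GRing.Theory.
Local Open Scope classical_set_scope.
Local Open Scope ring_scope.

(* The solutions x are counted inside {0, ..., n}^r, which loses none of them
   when all a i > 0, since then x i <= a i * x i <= n. *)
Definition restricted_partition (r : nat) (a : 'I_r -> nat) (n : nat) : nat :=
  #|[set x : {ffun 'I_r -> 'I_n.+1} | (\sum_(i < r) a i * x i)%N == n]%SET|.

Definition lcm_vec (r : nat) (a : 'I_r -> nat) : nat :=
  \big[lcmn/1%N]_(i < r) a i.

(* C is any algebraically closed field with a conjugation and a norm; the
   complex numbers R[i] over a real closed field R are an instance.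
   Only the values of P at the roots of unity of order dividing D matter. The
   sum ranges over a finite set, as D > 0 when all a i > 0. *)
Definition partition_decomposition (C : numClosedFieldType) (r : nat)
    (a : 'I_r -> nat) (P : C -> {poly C}) : Prop :=
  forall n : nat,
    (restricted_partition a n)%:R =
      \sum_(l \in [set l : C | l ^+ lcm_vec a = 1]) (P l).[n%:R] * l ^+ n.

Definition is_poly_part (C : numClosedFieldType) (r : nat) (a : 'I_r -> nat)
    (Q : {poly C}) : Prop :=
  exists2 P : C -> {poly C}, partition_decomposition a P & P 1 = Q.

(* The default value 0 of xget is never reached when all a i > 0: the
   decomposition then exists, and P is unique on the roots of unity. *)
Definition poly_part (C : numClosedFieldType) (r : nat) (a : 'I_r -> nat) :
    {poly C} :=
  xget 0 [set Q : {poly C} | is_poly_part a Q].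

(* x (x - 1) ... (x - k + 1) / k! as a polynomial in x *)
Definition binom_poly (C : numClosedFieldType) (k : nat) : {poly C} :=
  (k`!%:R)^-1 *: \prod_(i < k) ('X - (i%:R)%:P).

(* The entries are taken below D, which is harmless as D / a i <= D. *)
Definition box (r : nat) (a : 'I_r -> nat) :
    {set {ffun 'I_r -> 'I_(lcm_vec a)}} :=
  [set j : {ffun 'I_r -> 'I_(lcm_vec a)} |
    [forall i, (j i < lcm_vec a %/ a i)%N]]%SET.

(* Main.v *)
Require Import Defs.
From mathcomp Require Import all_boot all_order all_algebra.
From mathcomp Require Import cyclic separable cyclotomic.
From mathcomp Require Import classical_sets fsbigop.

Set Implicit Arguments.
Unset Strict Implicit.
Unset Printing Implicit Defensive.

Import GRing.Theory.
Local Open Scope ring_scope.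

(** Dividing each coordinate of a solution by D / a_i, where D is the lcm of
    the a_i, gives x_i = j_i + (D / a_i) y_i with j in the box and y a vector of
    arbitrary naturals, and the equation becomes n = s_j + D * sum_i y_i with
    s_j = sum_i a_i j_i.  So j contributes to p_a(n) only if n = s_j mod D, and
    then it contributes the number of compositions of m = (n - s_j) / D into r
    parts, binom(m + r - 1, r - 1).  This count is also right when n < s_j: as
    s_j < r D, the integer m + r - 1 then lies in [0, r - 1), where the binomial
    polynomial vanishes ([restricted_partitionE]).  Hence, for all n >= 0,
      p_a(n) = sum_j [n = s_j mod D] B_j(n),
    where B_j is the summand of the theorem.

    Over the complex numbers [n = s_j mod D] is the average of l^(n - s_j) over
    the D-th roots of unity l, so
      p_a(n) = sum_l (1/D sum_j l^(- s_j) B_j(n)) l^n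
    ([poly_componentsP]).  This is the decomposition that defines the polynomial
    part, and its component at l = 1 is the right-hand side of the theorem.

    There remains the uniqueness of the component at 1 ([quasipoly_eq0]).  If
    sum_l P_l(n) l^n = 0 for all n >= 0, then on the class of c mod D the
    polynomial sum_l l^c P_l has infinitely many roots, hence is zero; summing
    over c < D kills every l except 1 and leaves D P_1 = 0.

    In the lemmas the vector has r + 1 entries, so that r is the degree of the
    binomial polynomial. *)

(** * Counting the solutions by their residues modulo D / a_i *)

Section Counting.

Variables (r : nat) (a : 'I_r.+1 -> nat).
Hypothesis a_gt0 : forall i, (0 < a i)%N.

Let D := lcm_vec a.

Definition weight (j : {ffun 'I_r.+1 -> 'I_D}) : nat := (\sum_i a i * j i)%N.

Lemma dvdn_lcm_vec i : (a i %| D)%N.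
Proof. exact: (biglcmn_sup i). Qed.

Lemma lcm_vec_gt0 : (0 < D)%N.
Proof.
rewrite /D /lcm_vec; elim/big_ind: _ => // m n m_gt0 n_gt0.
by rewrite lcmn_gt0 m_gt0.
Qed.

Lemma mul_div_lcm_vec i : (a i * (D %/ a i) = D)%N.
Proof. by rewrite mulnC divnK ?dvdn_lcm_vec. Qed.

Lemma div_lcm_vec_gt0 i : (0 < D %/ a i)%N.
Proof. by rewrite divn_gt0 ?a_gt0 // dvdn_leq ?lcm_vec_gt0 ?dvdn_lcm_vec. Qed.

(** Each term a_i j_i is less than a_i (D / a_i) = D.  The strict inequality is
    what makes [weight_le] reach only zeros of the binomial polynomial. *)
Lemma weight_lt j : j \in box a -> (weight j < r.+1 * D)%N.
Proof.
rewrite inE => /forallP j_lt.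
have -> : (r.+1 * D = \sum_(i < r.+1) D)%N by rewrite sum_nat_const card_ord.
rewrite -[X in (X < _)%N]add0n /weight [X in (_ + X < _)%N]big_ord_recl.
rewrite add0n [X in (_ < X)%N]big_ord_recl -addSn leq_add //.
  by rewrite -[X in (_ < X)%N](mul_div_lcm_vec ord0) ltn_pmul2l ?j_lt.
apply: leq_sum => i _.
rewrite -[X in (_ <= X)%N](mul_div_lcm_vec (lift ord0 i)).
by rewrite leq_mul2l ltnW ?orbT ?j_lt.
Qed.

(** The difference n + (r + 1) D - weight j is positive and divisible by D,
    hence at least D.  So n + r D - weight j, the numerator in the shifted binomial,
    is an honest natural number although n - weight j may be negative. *)
Lemma weight_le j n :
  j \in box a -> (n == weight j %[mod D])%N -> (weight j <= n + r * D)%N.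
Proof.
move=> j_box n_mod; rewrite leqNgt; apply/negP => lt_w.
have dvd_w : (D %| weight j - (n + r * D))%N.
  by rewrite -eqn_mod_dvd 1?ltnW // addnC modnMDl eq_sym.
have le_D : (D <= weight j - (n + r * D))%N by rewrite dvdn_leq ?subn_gt0.
have := weight_lt j_box; rewrite ltnNge => /negP; apply.
by rewrite -(subnKC (ltnW lt_w)) mulSn addnC leq_add ?leq_addl.
Qed.

Lemma card_compositions m :
  #|[set y : {ffun 'I_r.+1 -> 'I_m.+1} | \sum_i y i == m]%N| = 'C(m + r, r).
Proof.
rewrite addnC -card_ord_partitions.
pose f (t : r.+1.-tuple 'I_m.+1) := [ffun i => tnth t i].
have f_inj : injective f.
  move=> t u /ffunP tu; apply: eq_from_tnth => i.
  by have := tu i; rewrite !ffunE.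
rewrite -(card_imset _ f_inj); apply: eq_card => y; rewrite inE.
apply/idP/imsetP => [sum_y|[t]].
  exists [tuple y i | i < r.+1].
    by rewrite inE big_tuple; under eq_bigr do rewrite tnth_mktuple.
  by apply/ffunP => i; rewrite ffunE tnth_mktuple.
by rewrite inE big_tuple => sum_t ->; under eq_bigr do rewrite ffunE.
Qed.

(** Since a_i (D / a_i) = D, the equation for x = j + (D / a) y depends on y only
    through the sum of its entries. *)
Lemma sum_box_shift (j : {ffun 'I_r.+1 -> 'I_D}) (y : 'I_r.+1 -> nat) :
  (\sum_i a i * (j i + D %/ a i * y i) = weight j + D * \sum_i y i)%N.
Proof.
rewrite big_distrr -big_split; apply: eq_bigr => i _ /=.
by rewrite mulnDr mulnA mul_div_lcm_vec.
Qed.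

(** Euclidean division by D / a_i is a bijection between the solutions with
    residues j and the compositions of m. *)
Lemma card_solutions_mod j n m : j \in box a -> n = (weight j + D * m)%N ->
  #|[set x : {ffun 'I_r.+1 -> 'I_n.+1} |
      (\sum_i a i * x i == n)%N & [forall i, x i %% (D %/ a i) == j i]%N]|
    = 'C(m + r, r).
Proof.
rewrite inE => /forallP j_lt n_eq.
(* The entries of y are bounded by m, and inord never truncates, because each
   entry of f y is at most n. *)
pose f (y : {ffun 'I_r.+1 -> 'I_m.+1}) : {ffun 'I_r.+1 -> 'I_n.+1} :=
  [ffun i => inord (j i + D %/ a i * y i)].
have fE (y : {ffun 'I_r.+1 -> 'I_m.+1}) i :
    (\sum_i y i == m)%N -> f y i = (j i + D %/ a i * y i)%N :> nat.
  move=> /eqP sum_y; rewrite ffunE inordK // ltnS.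
  rewrite [X in (_ <= X)%N]n_eq -[in X in (_ <= X)%N]sum_y -sum_box_shift.
  by rewrite (bigD1 i) //=; apply: leq_trans (leq_addr _ _); rewrite leq_pmull.
have f_inj : {in [set y : {ffun 'I_r.+1 -> 'I_m.+1} | \sum_i y i == m]%N &,
              injective f}.
  move=> y y'; rewrite !inE => sum_y sum_y' /ffunP fyy'.
  apply/ffunP => i; apply: val_inj => /=.
  have := congr1 val (fyy' i); rewrite /= !fE // => /addnI/eqP.
  by rewrite eqn_pmul2l ?div_lcm_vec_gt0 // => /eqP.
rewrite -card_compositions -(card_in_imset f_inj); apply: eq_card => x.
rewrite inE; apply/andP/imsetP => [[/eqP sum_x /forallP x_mod]|[y]].
  pose q i := (x i %/ (D %/ a i))%N.
  have xE i : x i = (j i + D %/ a i * q i)%N :> nat.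
    by rewrite -(eqP (x_mod i)) addnC mulnC -divn_eq.
  have sum_q : (\sum_i q i = m)%N.
    apply/eqP; rewrite -(eqn_pmul2l lcm_vec_gt0) -(eqn_add2l (weight j)).
    rewrite -sum_box_shift -n_eq -[X in _ == X]sum_x; apply/eqP.
    by apply: eq_bigr => i _; rewrite -xE.
  have q_lt i : (q i < m.+1)%N by rewrite ltnS -sum_q (bigD1 i) //= leq_addr.
  have sum_y : (\sum_i [ffun i => Ordinal (q_lt i)] i == m)%N.
    by under eq_bigr do rewrite ffunE /=; rewrite sum_q.
  exists [ffun i => Ordinal (q_lt i)]; first by rewrite inE.
  by apply/ffunP => i; apply: val_inj; rewrite /= fE // ffunE /= xE.
rewrite inE => sum_y ->; split.
  under eq_bigr do rewrite fE //.
  by rewrite sum_box_shift (eqP sum_y) -n_eq.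
by apply/forallP => i; rewrite fE // addnC mulnC modnMDl modn_small.
Qed.

(** The condition weight j <= n need not be imposed on the sum: for n < weight j
    there is no solution with residues j, and the binomial coefficient is zero
    because its upper entry is less than r. *)
Lemma restricted_partitionE n :
  restricted_partition a n =
    (\sum_(j in box a | n == weight j %[mod D])
       'C((n + r * D - weight j) %/ D, r))%N.
Proof.
have res_lt (x : {ffun 'I_r.+1 -> 'I_n.+1}) i : (x i %% (D %/ a i) < D)%N.
  by rewrite (leq_trans (ltn_pmod _ (div_lcm_vec_gt0 i))) ?leq_div.
pose res x : {ffun 'I_r.+1 -> 'I_D} := [ffun i => Ordinal (res_lt x i)].
rewrite /restricted_partition -sum1_card.
rewrite (partition_big res (fun j => j \in box a)) => [|x _] /=; last first.
  rewrite inE; apply/forallP => i.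
  by rewrite ffunE /= ltn_pmod ?div_lcm_vec_gt0.
rewrite [RHS]big_mkcondr; apply: eq_bigr => j j_box.
rewrite sum1_card.
transitivity #|[set x : {ffun 'I_r.+1 -> 'I_n.+1} |
    (\sum_i a i * x i == n)%N & [forall i, x i %% (D %/ a i) == j i]%N]|.
  apply: eq_card => x; rewrite !inE unfold_in /= inE; congr (_ && _).
  apply/eqP/forallP => [<- i|resx]; first by rewrite ffunE.
  by apply/ffunP => i; apply: val_inj; rewrite ffunE /= (eqP (resx i)).
have [n_eq|n_neq] := boolP ((weight j <= n)%N && (n == weight j %[mod D])%N).
  case/andP: n_eq => le_wn n_eq; rewrite n_eq.
  have /dvdnP [m n_w] : (D %| n - weight j)%N by rewrite -eqn_mod_dvd.
  have nE : n = (weight j + D * m)%N by rewrite mulnC -n_w subnKC.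
  rewrite (card_solutions_mod j_box nE) nE -addnA addKn.
  by rewrite (mulnC r) -mulnDr mulKn ?lcm_vec_gt0.
transitivity 0%N.
  apply: eq_card0 => x; rewrite inE; apply: contraNF n_neq.
  case/andP => /eqP sum_x /forallP x_mod.
  have -> : n = (weight j + D * \sum_i x i %/ (D %/ a i))%N.
    rewrite -[LHS]sum_x -sum_box_shift; apply: eq_bigr => i _.
    by rewrite -(eqP (x_mod i)) addnC (mulnC (D %/ a i)%N) -divn_eq.
  by rewrite leq_addr /= addnC mulnC modnMDl.
case: ifP n_neq => // n_mod; rewrite andbT -ltnNge => lt_nw.
rewrite bin_small // ltn_divLR ?lcm_vec_gt0 // ltn_subLR ?weight_le //.
by rewrite ltn_add2r.
Qed.

End Counting.

(** * Roots of unity and quasi-polynomials *)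

Lemma sum_expr_unity (R : idomainType) n (x : R) :
  x ^+ n = 1 -> \sum_(i < n) x ^+ i = if x == 1 then n%:R else 0.
Proof.
move=> xn1; case: eqVneq => [->|x_neq1].
  by under eq_bigr do rewrite expr1n; rewrite sumr_const card_ord.
apply/eqP; rewrite -(mulrI_eq0 _ (mulfI _ : GRing.lreg (x - 1))) ?subr_eq0 //.
by rewrite -subrX1 xn1 subrr.
Qed.

Lemma poly_eq0_inj (R : numDomainType) (p : {poly R}) (f : nat -> nat) :
  injective f -> (forall m, p.[(f m)%:R] = 0) -> p = 0.
Proof.
move=> f_inj p0.
apply: (@roots_geq_poly_eq0 _ p [seq (f m)%:R | m <- iota 0 (size p)]).
- by apply/allP => _ /mapP [m _ ->]; apply/eqP.
- rewrite map_inj_uniq ?iota_uniq // => k m /eqP.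
  by rewrite Num.Theory.eqr_nat => /eqP /f_inj.
- by rewrite size_map size_iota.
Qed.

Section RootsOfUnity.

Variables (C : numClosedFieldType) (n : nat).

(** X^n - 1 splits, and it is separable in characteristic 0. *)
Lemma prim_root_exists : (0 < n)%N -> exists z : C, n.-primitive_root z.
Proof.
move=> n_gt0; pose p : {poly C} := 'X^n - 1.
have [rs] := closed_field_poly_normal p.
rewrite lead_coefXnsubC // scale1r => p_eq.
have rs_unity : all n.-unity_root rs.
  apply/allP => x.
  by rewrite -[n.-unity_root x]/(root p x) p_eq root_prod_XsubC.
have rs_uniq : uniq rs.
  rewrite -separable_prod_XsubC -p_eq separable_Xn_sub_1 //.
  by rewrite Num.Theory.pnatr_eq0 -lt0n.
have /hasP [z _ z_prim] : has n.-primitive_root rs.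
  rewrite has_prim_root // -ltnS -(size_prod_XsubC rs idfun).
  by rewrite -(eq_bigr _ (fun _ _ => erefl)) /= -p_eq size_XnsubC.
by exists z.
Qed.

Variable z : C.
Hypothesis z_prim : n.-primitive_root z.

Let zn1 i : (z ^+ i) ^+ n = 1.
Proof. by rewrite exprAC (prim_expr_order z_prim) expr1n. Qed.

Lemma fsum_unity_roots (F : C -> C) :
  \sum_(l \in [set l : C | l ^+ n = 1]%classic) F l = \sum_(i < n) F (z ^+ i).
Proof.
pose s := [seq z ^+ i | i <- index_iota 0 n].
have -> : [set l : C | l ^+ n = 1]%classic = [set` s]%classic.
  apply/seteqP; split => l /=.
    move=> /(prim_rootP z_prim) [i ->]; apply/mapP; exists (val i) => //.
    by rewrite mem_index_iota ltn_ord.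
  by case/mapP => i _ ->; apply: zn1.
rewrite -fsbig_seq ?big_map ?big_mkord //.
rewrite map_inj_in_uniq ?iota_uniq // => i k; rewrite !mem_index_iota /=.
move=> lt_i lt_k /eqP; rewrite (eq_prim_root_expr z_prim) !modn_small //.
by move/eqP.
Qed.

(** The terms are the powers of x = z^k / z^w, and x = 1 exactly when k = w
    mod n. *)
Lemma sum_prim_root_div k w :
  \sum_(i < n) (z ^+ i) ^+ k / (z ^+ i) ^+ w =
    if (k == w %[mod n])%N then n%:R else 0.
Proof.
have z_neq0 : z != 0.
  by rewrite (prim_root_eq0 z_prim) -lt0n (prim_order_gt0 z_prim).
under eq_bigr do rewrite exprAC (exprAC z _ w) -exprVn -exprMn.
rewrite sum_expr_unity ?exprMn ?exprVn ?zn1 ?invr1 ?mulr1 //.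
rewrite -(eq_prim_root_expr z_prim).
rewrite -[z ^+ k == _](inj_eq (mulIf (invr_neq0 (expf_neq0 w z_neq0)))).
by rewrite mulfV ?expf_neq0.
Qed.

(** On the residue class of c mod n the powers l^m are constant, so the
    hypothesis becomes the vanishing of the honest polynomial sum_l l^c P_l;
    summing over c isolates l = 1 by orthogonality. *)
Lemma quasipoly_eq0 (P : C -> {poly C}) :
  (forall m : nat, \sum_(i < n) (P (z ^+ i)).[m%:R] * (z ^+ i) ^+ m = 0) ->
  P 1 = 0.
Proof.
move=> P0; have n_gt0 := prim_order_gt0 z_prim.
have class0 c : \sum_(i < n) (z ^+ i) ^+ c *: P (z ^+ i) = 0.
  apply: (@poly_eq0_inj _ _ (fun m => c + n * m)%N).
    by move=> k m /addnI /eqP; rewrite eqn_pmul2l // => /eqP.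
  move=> m; rewrite -[RHS](P0 (c + n * m)%N) horner_sum; apply: eq_bigr => i _.
  by rewrite hornerZ mulrC exprD exprM zn1 expr1n mulr1.
have : \sum_(c < n) \sum_(i < n) (z ^+ i) ^+ c *: P (z ^+ i) = 0.
  by apply: big1 => c _; apply: class0.
rewrite exchange_big /=.
under eq_bigr do rewrite -scaler_suml sum_expr_unity //.
rewrite (bigD1 (Ordinal n_gt0)) //= eqxx big1 ?addr0 => [/eqP|i i_neq0].
  by rewrite scaler_eq0 Num.Theory.pnatr_eq0 eqn0Ngt n_gt0 => /eqP.
by rewrite -(prim_order_dvd z_prim) gtnNdvd ?lt0n ?scale0r.
Qed.

End RootsOfUnity.

(** * The decomposition and its component at 1 *)

Lemma binom_poly_nat (C : numClosedFieldType) k m :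
  (binom_poly C k).[m%:R] = 'C(m, k)%:R.
Proof.
have prodE : \prod_(i < k) (m%:R - i%:R : C) = (m ^_ k)%:R.
  have [le_km|lt_mk] := leqP k m.
    rewrite ffact_prod natr_prod; apply: eq_bigr => i _.
    by rewrite natrB // (leq_trans (ltnW (ltn_ord i))).
  by rewrite ffact_small // (bigD1 (Ordinal lt_mk)) //= subrr mul0r.
rewrite hornerZ horner_prod; under eq_bigr do rewrite !hornerE.
rewrite prodE -bin_ffact natrM mulrC mulfK //.
by rewrite Num.Theory.pnatr_eq0 -lt0n fact_gt0.
Qed.

Section PolynomialPart.

Variables (C : numClosedFieldType) (r : nat) (a : 'I_r.+1 -> nat).
Hypothesis a_gt0 : forall i, (0 < a i)%N.

Let D := lcm_vec a.

Let D_neq0 : D%:R != 0 :> C.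
Proof. by rewrite Num.Theory.pnatr_eq0 -lt0n lcm_vec_gt0. Qed.

Definition box_poly (j : {ffun 'I_r.+1 -> 'I_D}) : {poly C} :=
  binom_poly C r \Po (D%:R^-1 *: ('X - ((weight j)%:R)%:P) + (r%:R)%:P).

(** Over D the argument (n - weight j) / D + r is the fraction
    (n + r D - weight j) / D, an exact quotient of naturals by [weight_le]. *)
Lemma box_poly_nat j n : j \in box a -> (n == weight j %[mod D])%N ->
  (box_poly j).[n%:R] = 'C((n + r * D - weight j) %/ D, r)%:R.
Proof.
move=> j_box n_mod; have le_w := weight_le a_gt0 j_box n_mod.
have /dvdnP [q q_eq] : (D %| n + r * D - weight j)%N.
  by rewrite -eqn_mod_dvd // addnC modnMDl.
rewrite horner_comp q_eq mulnK ?lcm_vec_gt0 // -binom_poly_nat; congr _.[_].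
have := congr1 (GRing.natmul (1 : C)) q_eq; rewrite natrB // natrD !natrM => qE.
rewrite !hornerE; apply: (mulfI D_neq0).
rewrite mulrDr mulVKf // [RHS]mulrC -qE.
by rewrite addrAC (mulrC r%:R).
Qed.

Definition poly_components (l : C) : {poly C} :=
  D%:R^-1 *: \sum_(j in box a) (l ^+ weight j)^-1 *: box_poly j.

Lemma poly_componentsP : partition_decomposition a poly_components.
Proof.
have [z z_prim] := prim_root_exists C (lcm_vec_gt0 a_gt0).
move=> n; rewrite (fsum_unity_roots z_prim) /= restricted_partitionE //.
rewrite natr_sum big_mkcondr /=.
under [RHS]eq_bigr do
  rewrite /poly_components hornerZ horner_sum -mulrA mulr_suml.
rewrite -mulr_sumr exchange_big /= mulr_sumr; apply: eq_bigr => j j_box.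
rewrite (eq_bigr (fun i : 'I_D => (box_poly j).[n%:R] *
  ((z ^+ i) ^+ n / (z ^+ i) ^+ weight j))) => [|i _]; last first.
  by rewrite hornerZ mulrC mulrA mulrC (mulrC (box_poly j).[_]) -mulrA.
rewrite -mulr_sumr (sum_prim_root_div z_prim); case: ifP => n_mod.
  by rewrite mulrCA mulVf // mulr1 box_poly_nat.
by rewrite !mulr0.
Qed.

Lemma component1_unique (P Q : C -> {poly C}) :
  partition_decomposition a P -> partition_decomposition a Q -> P 1 = Q 1.
Proof.
have [z z_prim] := prim_root_exists C (lcm_vec_gt0 a_gt0).
move=> decP decQ; apply/eqP; rewrite -subr_eq0; apply/eqP.
apply: (quasipoly_eq0 z_prim (P := fun l => P l - Q l)) => m.
under eq_bigr do rewrite hornerD hornerN mulrBl.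
rewrite sumrB; apply/eqP; rewrite subr_eq0; apply/eqP.
by move: (decP m); rewrite decQ !(fsum_unity_roots z_prim).
Qed.

End PolynomialPart.

Theorem theorem2 (C : numClosedFieldType) (r : nat) (a : 'I_r -> nat)
    (hr : (0 < r)%N) (ha : forall i : 'I_r, (0 < a i)%N) :
  let D := lcm_vec a in
  poly_part C a =
    (D%:R : C)^-1 *:
      \sum_(j in box a)
        (binom_poly C r.-1 \Po
          ((D%:R : C)^-1 *: ('X - ((\sum_(i < r) a i * j i)%N%:R)%:P)
            + ((r.-1)%:R)%:P)).
Proof.
case: r hr a ha => // r _ a a_gt0 /=.
transitivity (poly_components a (1 : C)).
  apply: xget_unique => [|_ [P decP <-]].
    by exists (@poly_components C r a) => //; apply: poly_componentsP.
  exact: component1_unique decP (poly_componentsP _ a_gt0).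
rewrite /poly_components /box_poly; congr (_ *: _); apply: eq_bigr => j _.
by rewrite expr1n invr1 scale1r.
Qed.
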